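(* Let $n \in \mathbb{N}^*$ be an integer that is not a prime power, and let $S$ be a zero-sumfree sequence in the cyclic group $C_n$ with $\mathsf{k}(S) \geq \mathsf{k}^*(C_n)$. Then $|S| \leq \lfloor n/2 \rfloor$.
   Context: A sequence in a finite abelian group $G$ (written additively) is a finite list $S=(g_1,\dots,g_\ell)$ of elements of $G$ (repetitions allowed), of length $|S|=\ell$. $S$ is zero-sumfree if $\sum_{i\in I} g_i \neq 0$ for every non-empty $I \subseteq \{1,\dots,\ell\}$. The cross number of $S$ is $\mathsf{k}(S)=\sum_{i=1}^{\ell} \frac{1}{\mathrm{ord}(g_i)}$. For a finite abelian group $G \simeq C_{\nu_1}\oplus\dots\oplus C_{\nu_s}$ written as a direct sum of cyclic groups of prime power orders $\nu_i>1$ (the longest possible such decomposition), $\mathsf{k}^*(G)=\sum_{i=1}^s \frac{\nu_i-1}{\nu_i}$; thus $\mathsf{k}^*(C_n)=\sum_{p^a \| n} \frac{p^a-1}{p^a}$, the sum over the prime powers $p^a$ exactly dividing $n$. *)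

(* Defs.v *)
From mathcomp Require Import all_boot all_order all_algebra all_fingroup.
From mathcomp Require Import all_solvable.

Set Implicit Arguments.
Unset Strict Implicit.
Unset Printing Implicit Defensive.

Import Order.TTheory GRing.Theory Num.Theory.

Local Open Scope ring_scope.

(* Bounding the base and the exponent by q makes the predicate boolean;        *)
(* prime_powerP shows that the bounds lose nothing. Note that 1 is not a       *)
(* prime power (the exponent is positive).                                     *)
Definition prime_power (q : nat) : bool :=
  [exists p : 'I_q.+1, [exists k : 'I_q.+1,
     [&& prime p, (0 < k)%N & q == (p ^ k)%N]]].

Definition zero_sumfree (G : zmodType) (S : seq G) : Prop :=
  forall I : {set 'I_(size S)}, I != set0 -> \sum_(i in I) S`_i != 0.

Definition cross_number (G : finZmodType) (S : seq G) : rat :=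
  \sum_(g <- S) (#[g]%g)%:R^-1.

(* G is the (internal) direct sum of the cyclic groups generated by the        *)
(* elements of B, whose orders are prime powers > 1. As these cyclic groups    *)
(* are nontrivial, the generators are distinct, so that a set suffices.        *)
Definition primary_decomposition (gT : finGroupType) (G B : {set gT}) : bool :=
  (\big[dprod/1%g]_(x in B) <[x]>%g == G)
    && [forall x in B, prime_power #[x]%g].

(* The value does not depend on the decomposition picked; for cyclic groups,   *)
(* see kstar_cyclic, which also covers existence.                              *)
Definition kstar (gT : finGroupType) (G : {set gT}) : rat :=
  if [pick B | primary_decomposition G B] is Some B
  then \sum_(x in B) (#[x]%g%:R - 1) / #[x]%g%:R
  else 0.

Lemma prime_powerP (q : nat) :
  reflect (exists p k : nat, [/\ prime p, (0 < k)%N & q = (p ^ k)%N])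
          (prime_power q).
Proof.
apply: (iffP existsP) => [[p /existsP[k /and3P[pp k0 /eqP qE]]]|[p [k [pp k0 qE]]]].
  by exists p, k.
have p1 := prime_gt1 pp.
have lep : (p < q.+1)%N.
  by rewrite ltnS qE -{1}(expn1 p) leq_exp2l.
have lek : (k < q.+1)%N by rewrite ltnS qE ltnW // ltn_expl.
by exists (Ordinal lep); apply/existsP; exists (Ordinal lek); apply/and3P; split=> //; apply/eqP.
Qed.

Lemma prime_powerE (p q : nat) : prime p -> (1 < q)%N -> p.-nat q -> prime_power q.
Proof.
move=> pp q1 pq; apply/prime_powerP; exists p, (logn p q); split=> //.
  rewrite lt0n; apply: contraTneq q1 => l0.
  by rewrite -(part_pnat_id pq) p_part l0.
by rewrite -p_part part_pnat_id.
Qed.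

Lemma primary_decomposition_cyclic (gT : finGroupType) (G : {group gT}) :
  cyclic G -> exists B, primary_decomposition G B.
Proof.
move=> cG; have nG := abelian_nil (cyclic_abelian cG).
pose g (p : nat) : gT := odflt 1%g [pick x | 'O_p(G)%g == <[x]>%g].
have gE (p : nat) : 'O_p(G)%g = <[g p]>%g.
  rewrite /g; case: pickP => [x /eqP //|no].
  have /cyclicP[x e] : cyclic 'O_p(G)%g by exact: cyclicS (pcore_sub _ _) cG.
  by have := no x; rewrite e eqxx.
have og p : p \in primes #|G| -> #[g p]%g = (#|G|`_p)%N.
  by move=> _; rewrite /order -gE (card_Hall (nilpotent_pcore_Hall _ nG)).
have pg p : p \in primes #|G| -> prime p /\ (1 < #[g p]%g)%N /\ p.-nat #[g p]%g.
  move=> pG; rewrite og // part_pnat; move: (pG); rewrite mem_primes => /and3P[pp G0 dv].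
  by rewrite p_part -{1}(expn0 p) ltn_exp2l ?prime_gt1 // logn_gt0.
have gI : {in primes #|G| &, injective g}.
  move=> p q /pg[pp [p1 pgp]] /pg[qq [_ qgq]] e; rewrite -e in qgq.
  apply/eqP; apply: contraTT p1 => npq; rewrite -leqNgt.
  suff /eqP->: #[g p]%g == 1%N by [].
  rewrite -(part_pnat_id pgp) part_p'nat //.
  by apply: sub_in_pnat qgq => r _ /eqnP->; rewrite !inE eq_sym.
exists [set x in map g (primes #|G|)].
apply/andP; split; last first.
  apply/forall_inP => x; rewrite inE => /mapP[p pG ->].
  by have [pp [p1 pn]] := pg _ pG; apply: prime_powerE pn.
have -> : (\big[dprod/1]_(x in [set x in map g (primes #|G|)]) <[x]>)%g
  = (\big[dprod/1]_(x <- map g (primes #|G|)) <[x]>)%g.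
  rewrite big_uniq ?(map_inj_in_uniq gI) ?primes_uniq //=.
  by apply: eq_bigl => x; rewrite inE.
apply/eqP; rewrite big_map -(eq_bigr _ (fun p _ => gE p)).
apply/eqP; rewrite eqEsubset.
apply/andP; split; [exact: Fitting_sub | exact: Fitting_max].
Qed.

Lemma primary_decomposition_coprime (gT : finGroupType) (G : {group gT})
    (B : {set gT}) (x y : gT) :
  cyclic G -> primary_decomposition G B -> x \in B -> y \in B -> x != y ->
  coprime #[x]%g #[y]%g.
Proof.
move=> cG /andP[/eqP defG _] xB yB nxy.
move: defG; rewrite (bigD1 x) //= (bigD1 y) /= ?yB 1?eq_sym // dprodA => defG.
have [[H _ defH _] _ _ _] := dprodP defG; rewrite defH in defG.
have sHG : H \subset G.
  by case/dprodP: defG => [[_ L _ ->] <- _ _]; exact: mulG_subl.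
rewrite /order -(cyclic_dprod defH) ?cycle_cyclic //.
exact: cyclicS sHG cG.
Qed.

Lemma kstar_cyclic (gT : finGroupType) (G : {group gT}) : cyclic G ->
  kstar G = \sum_(p <- primes #|G|) ((#|G|`_p)%:R - 1) / (#|G|`_p)%:R.
Proof.
move=> cG; rewrite /kstar; case: pickP => [B decB|noB]; last first.
  by have [B] := primary_decomposition_cyclic cG; rewrite noB.
have cop := primary_decomposition_coprime cG decB.
have [/eqP defG /forall_inP ppB] := andP decB.
have cardB : (\prod_(x in B) #[x]%g)%N = #|G| by exact: bigdprod_card defG.
pose f (x : gT) := pdiv #[x]%g.
have fP x : x \in B -> [/\ prime (f x), (1 < #[x]%g)%N & (f x).-nat #[x]%g].
  move=> xB; have /prime_powerP[p [k [pp k0 e]]] := ppB x xB.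
  have fE : f x = p by rewrite /f e; case: k k0 {e} => // k _; exact: pdiv_pfactor.
  rewrite fE e pnatX pnat_id //; split=> //.
  by rewrite -{1}(expn0 p) ltn_exp2l ?prime_gt1.
have fd x : x \in B -> (f x %| #[x]%g)%N by move=> _; apply: pdiv_dvd.
have fI : {in B &, injective f}.
  move=> x y xB yB efxy; apply/eqP; apply: contraT => nxy.
  have [pf _ _] := fP x xB.
  have := coprime_dvdr (fd y yB) (coprime_dvdl (fd x xB) (cop x y xB yB nxy)).
  by rewrite -efxy /coprime gcdnn => /eqP f1; rewrite f1 in pf.
have partE x : x \in B -> (#|G|`_(f x))%N = #[x]%g.
  move=> xB; have [pf _ pn] := fP x xB.
  rewrite -cardB (bigD1 x) //= partnM ?order_gt0 //; last first.
    by apply: prodn_cond_gt0 => y _; apply: order_gt0.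
  rewrite part_pnat_id // part_p'nat ?muln1 //.
  elim/big_rec: _ => [|y m /andP[yB nyx] IH]; first by [].
  rewrite pnatM IH andbT p'natE // -prime_coprime //.
  by apply: coprime_dvdl (fd x xB) (cop x y xB yB _); rewrite eq_sym.
have perm : perm_eq (map f (enum B)) (primes #|G|).
  apply: uniq_perm; rewrite ?primes_uniq //.
    rewrite map_inj_in_uniq ?enum_uniq // => x y; rewrite !mem_enum.
    exact: fI.
  move=> p; apply/mapP/idP => [[x]|].
    rewrite mem_enum => xB ->; have [pf _ _] := fP x xB.
    rewrite mem_primes pf cardG_gt0 -cardB (bigD1 x) //=.
    by rewrite dvdn_mulr // fd.
  rewrite mem_primes => /and3P[pp _]; rewrite -cardB Euclid_dvd_prod // big_orE.
  case/existsP=> x /andP[xB px]; exists x; rewrite ?mem_enum //.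
  have [pf _ pn] := fP x xB.
  by have /eqnP := (pnatP _ (order_gt0 x)) pn p pp px.
rewrite -(perm_big _ perm) /= big_map -big_enum /=.
by apply: eq_big_seq => x; rewrite mem_enum => xB; rewrite partE.
Qed.

(* Main.v *)
(** Call [b] a terminal element of [S] if deleting one copy of [b] from [S]
    loses only the total sum of [S] from the set [A(S)] of subset sums; a
    zero-sumfree [S] has at most one terminal element. Suppose [2|S| > n].
    Growing a subsequence [T] of [S] while keeping [|A(T)| >= 2|T|] must stop
    before [T = S], and when it stops all the remaining terms are equal to a
    terminal element of [S]. Starting from the empty sequence this yields [b],
    of multiplicity [M] say. Starting from the [M] copies of [b] together with
    another term [c] is therefore impossible, so [|A(b^M c)| < 2(M + 1)], which
    forces [c = r b] with [1 <= r <= M]. All terms of [S] are then of the form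
    [r_i b] with [r_i <= M], hence their subset sums fill an interval of
    multiples of [b], and [\sum r_i < ord b] by zero-sumfreeness. Thus
    [k(S) <= \sum r_i / ord b < 1], while [k*(C_n) >= 1] as soon as [n] has two
    distinct prime divisors. *)
Require Import Defs.
From mathcomp Require Import all_boot all_order all_algebra all_fingroup.
From mathcomp Require Import all_solvable.
From mathcomp Require Import zify.

Import Order.TTheory GRing.Theory Num.Theory.

Local Open Scope ring_scope.

Section SubsetSums.

Set Implicit Arguments.
Unset Strict Implicit.

Variable G : finZmodType.
Implicit Types (S T U s t : seq G) (a b c x y : G).

(** * Subset sums of a sequence *)

Definition add_term x (A : {set G}) : {set G} := [set y | (y \in A) || (y - x \in A)].

Definition subsums s : {set G} := foldr add_term [set 0] s.

Lemma in_subsums_cons x s y :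
  (y \in subsums (x :: s)) = (y \in subsums s) || (y - x \in subsums s).
Proof. by rewrite inE. Qed.

Lemma subsums_consl x s y : y \in subsums s -> y \in subsums (x :: s).
Proof. by rewrite in_subsums_cons => ->. Qed.

Lemma subsums_consr x s y : y \in subsums s -> y + x \in subsums (x :: s).
Proof. by rewrite in_subsums_cons addrK orbC => ->. Qed.

Lemma subsums0 s : 0 \in subsums s.
Proof. by elim: s => [|x s IH]; [rewrite inE | exact: subsums_consl]. Qed.

Lemma subsums_perm s t : perm_eq s t -> subsums s = subsums t.
Proof.
have addC x y A : add_term x (add_term y A) = add_term y (add_term x A).
  by apply/setP => z; rewrite !inE addrAC !orbA (orbAC (z \in A)).
have foldC x s' A : foldr add_term (add_term x A) s' = add_term x (foldr add_term A s').
  by elim: s' => //= y s' ->.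
move=> st; apply: (@catCA_perm_ind _ (fun t => subsums s = subsums t) _ _ _ st erefl).
move=> s1 s2 s3 ->; rewrite /subsums !foldr_cat.
by elim: s1 => //= x s1 ->; rewrite foldC.
Qed.

(** Links the recursive [subsums] to the index sets used in [zero_sumfree]. *)
Lemma subsums_map (J : eqType) (f : J -> G) (r : seq J) y : uniq r ->
  y \in subsums (map f r) ->
  exists2 t : seq J, uniq t /\ {subset t <= r} & y = \sum_(i <- t) f i.
Proof.
elim: r y => [|j r IH] y /=.
  by rewrite inE => _ /eqP->; exists [::]; rewrite ?big_nil.
case/andP=> jr ur; rewrite in_subsums_cons => /orP[] /(IH _ ur)[t [ut tr] e].
  by exists t => //; split=> // i /tr ir; rewrite inE ir orbT.
exists (j :: t); last by rewrite big_cons -e addrC subrK.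
split=> /=; first by rewrite ut andbT; apply: contra jr => /tr.
by move=> i; rewrite !inE => /orP[->//|/tr ->]; rewrite orbT.
Qed.

(** The complementary subsequence has this sum. *)
Lemma subsums_sumB s y : y \in subsums s -> \sum_(x <- s) x - y \in subsums s.
Proof.
elim: s y => [|x s IH] y; first by rewrite !inE big_nil => /eqP->; rewrite subr0.
rewrite in_subsums_cons big_cons => /orP[] /IH h.
  by rewrite -addrA addrC; apply: subsums_consr.
by rewrite opprB addrA (addrC _ x) in h; apply: subsums_consl.
Qed.

Lemma subsums_sum s : \sum_(x <- s) x \in subsums s.
Proof. by rewrite -[X in X \in _]subr0 subsums_sumB ?subsums0. Qed.

Lemma subsums_cons_split x s : subsums (x :: s) = subsums s :|: [set y + x | y in subsums s].
Proof.
apply/setP => y; rewrite in_subsums_cons in_setU; congr (_ || _).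
apply/idP/imsetP => [h|[z h ->]]; last by rewrite addrK.
by exists (y - x) => //; rewrite subrK.
Qed.

(** * Zero-sumfree sequences *)

Definition zsf S := forall x s, perm_eq S (x :: s) -> - x \notin subsums s.

Lemma zsf_perm S T : perm_eq S T -> zsf S -> zsf T.
Proof. by move=> ST hS x s Ts; apply: (hS x); apply: perm_trans ST Ts. Qed.

Lemma zsf_behead x s : zsf (x :: s) -> zsf s.
Proof.
move=> h y t st; apply: contra (h y (x :: t) _); first exact: subsums_consl.
by rewrite perm_sym (perm_catCA [:: y] [:: x] t) /= perm_cons perm_sym.
Qed.

Lemma zsf_catr s t : zsf (s ++ t) -> zsf t.
Proof. by elim: s => //= x s IH /zsf_behead. Qed.

Lemma zsf_sum_neq0 x s : zsf (x :: s) -> \sum_(y <- x :: s) y != 0.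
Proof.
move=> h; apply: contra (h x s (perm_refl _)) => /eqP; rewrite big_cons => /eqP.
by rewrite addr_eq0 => /eqP->; rewrite opprK subsums_sum.
Qed.

(** If the other terms had [- x] as a subset sum, it would come from indices [t] avoiding the index
    [i] of [x]; adjoining [i] gives a nonempty zero sum. *)
Lemma zero_sumfree_zsf S : zero_sumfree S -> zsf S.
Proof.
move=> h x s Sxs; apply/negP => xs.
have SE : S = [seq S`_(i : 'I_(size S)) | i <- enum 'I_(size S)].
  by rewrite map_comp val_enum_ord -/(mkseq _ _) mkseq_nth.
have : x \in S by rewrite (perm_mem Sxs) inE eqxx.
rewrite {1}SE => /mapP[i iS xE].
have sE : perm_eq s [seq S`_(j : 'I_(size S)) | j <- rem i (enum 'I_(size S))].
  rewrite -(perm_cons x); apply: (@perm_trans _ S); first by rewrite perm_sym.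
  by rewrite {1}SE xE; apply: (perm_map _ (perm_to_rem iS)).
move: xs; rewrite (subsums_perm sE).
case/(subsums_map (rem_uniq _ (enum_uniq _))) => t [ut tr] e.
have it : i \notin t.
  by apply/negP => /tr; rewrite mem_rem_uniq ?enum_uniq // !inE eqxx.
have /h/negP[] : i |: [set j in t] != set0 by apply/set0Pn; exists i; rewrite !inE eqxx.
rewrite big_setU1 ?inE //= (eq_bigl (mem t)); last by move=> j; rewrite inE.
by rewrite -big_uniq //= -e -xE subrr.
Qed.

(** Each new term contributes at least the new total: were that an old sum, its complement in the
    old total would be [- x]. *)
Lemma card_subsums_zsf s : zsf s -> (size s < #|subsums s|)%N.
Proof.
elim: s => [|x s IH] h; first by rewrite cards1.
apply: leq_ltn_trans (IH (zsf_behead h)) _; apply: proper_card.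
apply/properP; split; first by apply/subsetP => y; apply: subsums_consl.
exists (\sum_(y <- s) y + x); first exact/subsums_consr/subsums_sum.
apply: contra (h x s (perm_refl _)) => /subsums_sumB.
by rewrite opprD addrA subrr add0r.
Qed.

(** * Almost stability and terminal elements *)

Definition almost_stable s b :=
  forall x, x \in subsums s -> x != \sum_(y <- s) y -> x + b \in subsums s.

Definition terminal S b := exists2 s, perm_eq S (b :: s) & almost_stable s b.

Lemma almost_stable_perm s t b : perm_eq s t -> almost_stable s b -> almost_stable t b.
Proof. by move=> st h x; rewrite -(subsums_perm st) -(perm_big _ st); apply: h. Qed.

(** Taking complements in the total turns adding [b] into subtracting it. *)
Lemma almost_stableB s b y :
  almost_stable s b -> y \in subsums s -> y != 0 -> y - b \in subsums s.
Proof.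
move=> h ys y0; have := h _ (subsums_sumB ys).
rewrite subr_eq addrC -subr_eq subrr eq_sym => /(_ y0) /subsums_sumB.
by rewrite opprD opprB addrA addrCA subrr addr0.
Qed.

Lemma in_subsums_cons_stable s b x : almost_stable s b -> x \in subsums (b :: s) ->
  x != \sum_(y <- b :: s) y -> x \in subsums s.
Proof.
move=> h; rewrite in_subsums_cons big_cons => /orP[//|xb xs].
by rewrite -(subrK b x); apply: h => //; rewrite subr_eq addrC.
Qed.

Lemma almost_stable_cons s b : almost_stable s b -> almost_stable (b :: s) b.
Proof. by move=> h x xs /(in_subsums_cons_stable h xs); apply: subsums_consr. Qed.

(** The total of [b :: s] is always a new sum; a failure of almost stability would give a second
    one. *)
Lemma almost_stable_of_card s b : zsf (b :: s) ->
  (#|subsums (b :: s)| <= #|subsums s|.+1)%N -> almost_stable s b.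
Proof.
move=> h le x xs xn; apply: contraTT le => xbs; rewrite -ltnNge.
set t := \sum_(y <- s) y in xn.
have tbs : t + b \notin subsums s.
  apply: contra (h b s (perm_refl _)) => /subsums_sumB.
  by rewrite opprD addrA subrr add0r.
have <- : #|(t + b) |: ((x + b) |: subsums s)| = #|subsums s|.+2.
  rewrite !cardsU1 xbs inE (negPf tbs) orbF inE.
  by rewrite (inj_eq (addIr b)) eq_sym xn.
apply/subset_leq_card/subsetP => y; rewrite 2!in_setU1 => /or3P[/eqP->|/eqP->|ys].
- exact/subsums_consr/subsums_sum.
- exact: subsums_consr.
- exact: subsums_consl.
Qed.

(** If [b] and [c] differ, start from the subset sum [b] and subtract [c], then [b]: this stays
    among the subset sums and reaches [- c]. *)
Lemma almost_stable_uniq x s b c : zsf (x :: s) -> - b \notin subsums (x :: s) ->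
  - c \notin subsums (x :: s) -> almost_stable (x :: s) b ->
  almost_stable (x :: s) c -> b = c.
Proof.
move=> h bns cs hb hc; have s0 := zsf_sum_neq0 h.
have bs : b \in subsums (x :: s).
  by rewrite -[b]add0r; apply: hb (subsums0 _) _; rewrite eq_sym.
have b0 : b != 0.
  by apply: contraNneq bns => ->; rewrite oppr0 subsums0.
apply/eqP; rewrite -subr_eq0; apply: contraNT cs => bc.
have := almost_stableB hb (almost_stableB hc bs b0) bc.
by rewrite addrAC subrr add0r.
Qed.

Lemma terminal_stable S b : terminal S b -> almost_stable S b.
Proof.
case=> s Ss hs; apply: almost_stable_perm (almost_stable_cons hs).
by rewrite perm_sym.
Qed.

Lemma terminal_mem S b : terminal S b -> b \in S.
Proof. by case=> s Ss _; rewrite (perm_mem Ss) inE eqxx. Qed.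

Lemma zsf_mem_neq0 S b : zsf S -> b \in S -> b != 0.
Proof.
move=> h /perm_to_rem bS; apply: contraNneq (h _ _ bS) => ->.
by rewrite oppr0 subsums0.
Qed.

Lemma subsums_mem S b : b \in S -> b \in subsums S.
Proof.
move=> /perm_to_rem bS; rewrite (subsums_perm bS) -[b in b \in _]add0r.
exact/subsums_consr/subsums0.
Qed.

(** Again [- c] is reached from [b] through [b - c]. Now [c] is itself a term, and any sum other
    than the total survives its removal, so [- c] must be the total. *)
Lemma terminal_opp S b c : zsf S -> terminal S b -> terminal S c -> b != c ->
  - c = \sum_(x <- S) x.
Proof.
move=> h tb [s Ss hc] bc; apply/eqP.
have tc : terminal S c by exists s.
have bS := terminal_mem tb; have b0 := zsf_mem_neq0 h bS.
have cS : - c \in subsums S.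
  have := almost_stableB (terminal_stable tb)
    (almost_stableB (terminal_stable tc) (subsums_mem bS) b0).
  by rewrite subr_eq0 addrAC subrr add0r; apply.
apply: contraNT (h _ _ Ss) => cn; rewrite (perm_big _ Ss) in cn.
by apply: in_subsums_cons_stable hc _ cn; rewrite -(subsums_perm Ss).
Qed.

Lemma terminal_uniq S b c : zsf S -> terminal S b -> terminal S c -> b = c.
Proof.
move=> h tb tc; apply/eqP; apply/negP => /negP bc; case/negP: (bc); apply/eqP.
apply: oppr_inj; rewrite (terminal_opp h tb tc bc).
by rewrite (terminal_opp h tc tb) // eq_sym.
Qed.

Lemma terminal_nseq S b m s : perm_eq S (nseq m.+1 b ++ s) -> almost_stable s b ->
  terminal S b.
Proof.
move=> Ss hs; exists (nseq m b ++ s); first exact: Ss.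
by elim: m {Ss} => //= m IH; apply: almost_stable_cons.
Qed.

(** * Greedy growth of a subsequence *)

Lemma perm_rem_cat c R T : c \in R -> perm_eq (R ++ T) (rem c R ++ c :: T).
Proof.
move=> cR; rewrite -cat_rcons perm_cat2r; apply: perm_trans (perm_to_rem cR) _.
by rewrite perm_sym perm_rcons.
Qed.

(** [T] absorbs terms of [R] as long as the bound [hT] persists. It cannot absorb all of [R], since
    [S] would then have more subset sums than [G] has elements. *)
Lemma greedy S T R : zsf S -> perm_eq S (R ++ T) -> (#|G| < 2 * size S)%N ->
  (2 * size T <= #|subsums T|)%N -> exists2 b, b \in R & terminal S b.
Proof.
elim: {R}(size R) {-2}R (erefl (size R)) T => [|k IH] R sR T hS ST nS hT.
  move: ST; rewrite (size0nil sR) => ST.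
  have leG : (#|subsums T| <= #|G|)%N by apply: max_card.
  by rewrite (perm_size ST) ltnNge (leq_trans hT leG) in nS.
have STc c : c \in R -> perm_eq S (rem c R ++ c :: T).
  by move=> cR; apply: perm_trans ST (perm_rem_cat T cR).
have [/hasP[c cR cT]|] := boolP (has (fun c => 2 * (size T).+1 <= #|subsums (c :: T)|) R)%N.
  have [|b bR tb] := IH (rem c R) _ (c :: T) hS (STc c cR) nS cT.
    by rewrite size_rem // sR.
  by exists b => //; apply: mem_rem bR.
(* Growth is stuck: each remaining [c] yields at most [2|T| + 1] sums, hence at most one more than
   [T] has. *)
move/hasPn => hR.
have hc c : c \in R -> zsf (c :: T) /\ almost_stable T c.
  move=> cR; have z : zsf (c :: T) by apply: zsf_catr (zsf_perm (STc c cR) hS).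
  split=> //; apply: almost_stable_of_card => //.
  by have := hR c cR; lia.
case: R sR ST {STc} hR hc => // b R _ ST hR hc.
have bR : b \in b :: R by rewrite inE eqxx.
(* The empty [T] is never stuck, as one term already gives two sums; [almost_stable_uniq] needs a
   nonempty [T]. *)
case: T ST hT hR hc => [|x T] ST hT hR hc.
  have := hR b bR; have := card_subsums_zsf (hc b bR).1; rewrite /=; lia.
exists b => //; apply: (@terminal_nseq _ _ (size R) (x :: T) _ (hc b bR).2).
suff <- : b :: R = nseq (size R).+1 b by [].
apply: (all_pred1P b (b :: R) _); apply/allP => c cR; apply/eqP/esym.
have [zc hcc] := hc c cR; have [zb hb] := hc b bR.
exact: almost_stable_uniq (zsf_behead zb) (zb b _ (perm_refl _))
  (zc c _ (perm_refl _)) hb hcc.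
Qed.

(** * Intervals of multiples of one element *)

Definition smooth b S k := [/\ (k < #[b]%g)%N,
  forall j, (j <= k)%N -> b *+ j \in subsums S &
  cross_number S <= k%:R / #[b]%g%:R].

Lemma mulrn_eq0_order b k : (b *+ k == 0) = (#[b]%g %| k)%N.
Proof. by rewrite order_dvdn FinRing.zmodXgE FinRing.zmod1gE. Qed.

Lemma order_mulrn_ge b r : (0 < r)%N -> (#[b]%g <= r * #[(b *+ r)%R]%g)%N.
Proof.
move=> r0; apply: dvdn_leq; first by rewrite muln_gt0 r0 order_gt0.
by rewrite -mulrn_eq0_order mulrnA mulrn_eq0_order.
Qed.

(** [k] accumulates the coefficients [r]. With [r <= k + 1] there is no gap between the old interval
    and its translate; if [k + r] reached the order of [b], the inverse of the new term would lie in
    the old interval. *)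
Lemma smooth_cons b S k r : smooth b S k -> (0 < r <= k.+1)%N ->
  zsf (b *+ r :: S) -> smooth b (b *+ r :: S) (k + r).
Proof.
move=> [kN hA hk] /andP[r0 rk] h; split.
- rewrite ltnNge; apply: contra (h _ _ (perm_refl _)) => Nkr.
  have -> : - (b *+ r) = b *+ (#[b]%g - r).
    apply/eqP; rewrite eq_sym -addr_eq0 -mulrnDr subnK; last by lia.
    by rewrite mulrn_eq0_order.
  by apply: hA; lia.
- move=> j jkr; case: (leqP j k) => [/hA|kj]; first exact: subsums_consl.
  have -> : j = (j - r + r)%N by lia.
  by rewrite mulrnDr; apply: subsums_consr; apply: hA; lia.
- rewrite /cross_number big_cons natrD mulrDl addrC lerD //.
  rewrite -[X in X <= _]mul1r ler_pdivrMr ?ltr0n ?order_gt0 // mulrAC.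
  rewrite ler_pdivlMr ?ltr0n ?order_gt0 // mul1r -natrM ler_nat.
  exact: order_mulrn_ge.
Qed.

Lemma smooth_nil b : smooth b [::] 0%N.
Proof.
split; first exact: order_gt0.
  by move=> j; rewrite leqn0 => /eqP->; rewrite mulr0n subsums0.
by rewrite /cross_number big_nil mul0r.
Qed.

Lemma smooth_nseq b m : zsf (nseq m b) -> smooth b (nseq m b) m.
Proof.
elim: m => [|m IH] /= h; first exact: smooth_nil.
by have := smooth_cons (r := 1%N) (IH (zsf_behead h)); rewrite mulr1n addn1; apply.
Qed.

(** With the [m] copies of [b] in place first, every coefficient is small enough for [smooth_cons],
    whatever the order of [R]. *)
Lemma smooth_cat b m R : zsf (R ++ nseq m b) ->
  (forall c, c \in R -> exists2 r, (0 < r <= m)%N & c = b *+ r) ->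
  exists2 k, (m <= k)%N & smooth b (R ++ nseq m b) k.
Proof.
elim: R => [|c R IH] /= h hR; first by exists m => //; apply: smooth_nseq.
have [|k mk sk] := IH (zsf_behead h).
  by move=> d dR; apply: hR; rewrite inE dR orbT.
have [r /andP[r0 rm] cE] := hR c (mem_head _ _).
rewrite cE in h *; exists (k + r)%N; first lia.
by apply: smooth_cons => //; lia.
Qed.

(** * Long zero-sumfree sequences *)

Lemma card_subsums_cons c s : [disjoint subsums s & [set y + c | y in subsums s]] ->
  #|subsums (c :: s)| = (2 * #|subsums s|)%N.
Proof.
move=> d; rewrite subsums_cons_split cardsU disjoint_setI0 // cards0 subn0.
by rewrite card_imset ?addnn ?mul2n //; apply: addIr.
Qed.

Lemma subsums_nseq b m y : y \in subsums (nseq m b) -> exists2 i, (i <= m)%N & y = b *+ i.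
Proof.
elim: m y => [|m IH] y; first by rewrite inE => /eqP->; exists 0%N.
rewrite in_subsums_cons => /orP[] /IH[i im e]; first by exists i => //; apply: leqW.
by exists i.+1 => //; rewrite mulrSr -e subrK.
Qed.

Lemma mulrn_subsums_nseq b m i : (i <= m)%N -> b *+ i \in subsums (nseq m b).
Proof.
elim: m i => [|m IH] [|i] // im; rewrite ?mulr0n ?subsums0 //.
by rewrite mulrSr; apply: subsums_consr; apply: IH.
Qed.

Lemma long_zsf_smooth S : zsf S -> (#|G| < 2 * size S)%N ->
  exists b T k, perm_eq S T /\ smooth b T k.
Proof.
move=> h nS.
have [|b _ tb] := @greedy S [::] S h _ nS isT; first by rewrite cats0.
set m := count_mem b S; set R := [seq c <- S | c != b].
have SE : perm_eq S (R ++ nseq m b).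
  have <- : [seq x <- S | pred1 b x] = nseq m b.
    by rewrite /m -size_filter; apply/all_pred1P; apply: filter_all.
  by rewrite perm_sym perm_catC; apply/permPl/perm_filterC.
have zR : zsf (R ++ nseq m b) by apply: zsf_perm h.
have hR c : c \in R -> exists2 r, (0 < r <= m)%N & c = b *+ r.
  move=> cR; have SEc : perm_eq S (rem c R ++ c :: nseq m b).
    exact: perm_trans SE (perm_rem_cat _ cR).
  have zc := zsf_catr (zsf_perm SEc h).
  (* Otherwise [c] doubles the at least [m + 1] sums, so [greedy] can start from [c] and all copies
     of [b], and leaves a terminal element in [R]. By uniqueness this is [b], which [R] does not
     contain. *)
  have : ~~ [disjoint subsums (nseq m b) & [set y + c | y in subsums (nseq m b)]].
    apply/negP => /card_subsums_cons cE.
    have := card_subsums_zsf (zsf_behead zc); rewrite size_nseq => mc.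
    have [|b' b'R tb'] := greedy h SEc nS; first by rewrite cE /= size_nseq leq_mul2l.
    move: b'R; rewrite -(terminal_uniq h tb tb') => /mem_rem.
    by rewrite mem_filter eqxx.
  rewrite -setI_eq0 => /set0Pn[y]; rewrite inE.
  case/andP=> /subsums_nseq[i im yi] /imsetP[z /subsums_nseq[j jm ->] e].
  (* Now [i b = j b + c]; if [i <= j], then [- c] is a sum of copies of [b]. *)
  case: (leqP i j) => ij.
    have := zc _ _ (perm_refl _).
    have -> : - c = b *+ (j - i).
      by rewrite mulrnBr // -yi e opprD addrA subrr add0r.
    by rewrite mulrn_subsums_nseq //; lia.
  exists (i - j)%N; first lia.
  by rewrite mulrnBr 1?ltnW // -yi e addrAC subrr add0r.
have [k _ sk] := smooth_cat zR hR.
by exists b, (R ++ nseq m b), k.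
Qed.

Lemma cross_number_perm S T : perm_eq S T -> cross_number S = cross_number T.
Proof. by move=> ST; apply: perm_big. Qed.

Lemma long_zsf_cross_number S : zsf S -> (#|G| < 2 * size S)%N -> cross_number S < 1.
Proof.
move=> h nS; have [b [T [k [ST [kN _ hk]]]]] := long_zsf_smooth h nS.
rewrite (cross_number_perm ST); apply: le_lt_trans hk _.
by rewrite ltr_pdivrMr ?ltr0n ?order_gt0 // mul1r ltr_nat.
Qed.

End SubsetSums.

(** * The lower bound for the invariant of the group *)

Lemma kstar_cyclic_ge1 (gT : finGroupType) (G : {group gT}) :
  cyclic G -> (1 < #|G|)%N -> ~~ prime_power #|G| -> 1 <= kstar G.
Proof.
move=> cG n1 npp; rewrite kstar_cyclic //; set n := #|G| in n1 npp *.
(* Each summand is [1 - 1/q] with [q >= 2]. *)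
have term p : p \in primes n -> 2^-1 <= ((n`_p)%:R - 1) / (n`_p)%:R :> rat.
  rewrite mem_primes => /and3P[pp n0 pn].
  have : (1 < n`_p)%N by rewrite p_part -{1}(expn0 p) ltn_exp2l ?prime_gt1 // logn_gt0 mem_primes pp n0.
  move: (n`_p)%N => q q1; rewrite mulrBl divff ?pnatr_eq0 ?mul1r; last by lia.
  rewrite lerBrDr -lerBrDl (_ : 1 - 2^-1 = 2^-1 :> rat) //.
  by rewrite lef_pV2 ?posrE ?ltr0n ?ler_nat //; lia.
case pE: (primes n) term => [|p [|q s]] term.
- have : pdiv n \in primes n by rewrite mem_primes pdiv_prime // pdiv_dvd (ltnW n1).
  by rewrite pE.
- case/negP: npp; have : p \in primes n by rewrite pE mem_head.
  rewrite mem_primes => /and3P[pp _ _]; apply: (prime_powerE pp n1).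
  apply/pnatP => [|r pr rn]; first exact: ltnW.
  have : r \in primes n by rewrite mem_primes pr rn (ltnW n1).
  by rewrite pE inE.
(* The splitting of 1 matches two primes, each giving at least 1/2, and a nonnegative tail. *)
rewrite !big_cons addrA (_ : 1 = 2^-1 + 2^-1 + 0 :> rat) //.
apply: lerD; first by apply: lerD; apply: term; rewrite !inE eqxx ?orbT.
rewrite big_seq; apply: sumr_ge0 => r rs; apply: le_trans (term r _) => //.
by rewrite !inE rs !orbT.
Qed.

Theorem theorem7p2 (n : nat) (n_gt0 : (0 < n)%N) (n_npp : ~~ prime_power n)
    (G : finZmodType) (cycG : cyclic [set: G]) (cardG : #|[set: G]| = n)
    (S : seq G) (S_zsf : zero_sumfree S)
    (kS : kstar [set: G] <= cross_number S) :
  (size S <= n %/ 2)%N.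
Proof.
have h := zero_sumfree_zsf S_zsf; have nE : #|G| = n by rewrite -cardG cardsT.
rewrite leqNgt; apply/negP => nS.
have long : (#|G| < 2 * size S)%N by rewrite nE; lia.
(* [n_npp] allows [n = 1], but [S] is nonempty by [nS] and has more than [|S|] subset sums. *)
have n1 : (1 < n)%N.
  have leG : (#|subsums S| <= #|G|)%N by apply: max_card.
  by have := card_subsums_zsf h; lia.
have := long_zsf_cross_number h long; rewrite ltNge; case/negP.
by apply: le_trans kS; apply: kstar_cyclic_ge1; rewrite ?cardG.
Qed.
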